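(* Let $t_0, r\in\mathbb{R}$ with $r>0$ and let $I:=[t_0,t_0+r]$. Suppose that $f:I\times I\times\mathbb{R}\to\mathbb{R}$ is a continuous function satisfying the Lipschitz condition $$|f(t,s,z_1)-f(t,s,z_2)|\leq L|z_1-z_2|$$ for all $t,s\in I$, all $z_1,z_2\in\mathbb{R}$ and some $L>0$. Let $\varepsilon\geq 0$ and let $\eta$ be an arbitrary fixed real number with $\eta>L$. If a continuous function $y:I\to\mathbb{R}$ satisfies $$\left|y(t)-\int_{t_0}^{t}f(t,s,y(s))\,ds\right|\leq\varepsilon$$ for all $t\in I$, then there exists a unique solution $y_0:I\to\mathbb{R}$ of the Volterra integral equation $$y_0(t)=\int_{t_0}^{t}f(t,s,y_0(s))\,ds,\qquad t\in I,$$ satisfying $$|y(t)-y_0(t)|\leq\frac{\varepsilon\,e^{\eta r}}{1-L/\eta}$$ for all $t\in I$.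
   Context: A solution of the Volterra integral equation on $I$ is a continuous function $y_0:I\to\mathbb{R}$ satisfying the equation for every $t\in I$. *)

(* Defs.v *)
From Stdlib Require Import Reals.
From Coquelicot Require Import Coquelicot.
Open Scope R_scope.

(* Functions on [a, b] are represented by total functions on R: every notion
   below constrains them on the interval only, continuity at the endpoints
   being relative to the interval. *)
Definition segment (a b x : R) : Prop := a <= x <= b.

Definition continuous_kernel (a b : R) (f : R -> R -> R -> R) : Prop :=
  continuous_on
    (fun p : R * R * R => segment a b (fst (fst p)) /\ segment a b (snd (fst p)))
    (fun p : R * R * R => f (fst (fst p)) (snd (fst p)) (snd p)).

Definition volterra_solution (a b : R) (f : R -> R -> R -> R) (y : R -> R) : Prop :=
  continuous_on (segment a b) y /\
  forall t : R, segment a b t -> y t = RInt (fun s => f t s (y s)) a t.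

(* Main.v *)
(** In the weighted distance sup |u t - v t| exp (- eta (t - t0)) the Volterra
    operator is a contraction of ratio L / eta < 1, and y moves by at most eps
    under it. Hence the Picard iterates of y converge geometrically to a fixed
    point within eps / (1 - L / eta) of y for the weighted distance; removing
    the weight costs the factor exp (eta r). *)

Require Import Defs.
From Stdlib Require Import Reals Lra Lia.
From Coquelicot Require Import Coquelicot.
Open Scope R_scope.

(** * Relative continuity and the retraction onto an interval *)

Lemma continuous_on_comp {T U V : UniformSpace} (D : U -> Prop)
    (phi : T -> U) (f : U -> V) (x : T) :
  (forall x', D (phi x')) -> continuous phi x -> continuous_on D f ->
  continuous (fun x' => f (phi x')) x.
Proof.
  intros HD Hphi Hf.
  apply (filterlim_comp _ _ _ phi f (locally x) (within D (locally (phi x)))).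
  - intros P HP. generalize (Hphi _ HP). unfold filtermap, within.
    apply filter_imp. intros x' H. exact (H (HD x')).
  - exact (Hf _ (HD x)).
Qed.

Lemma continuous_pair {T U V : UniformSpace} (f : T -> U) (g : T -> V) (x : T) :
  continuous f x -> continuous g x -> continuous (fun x' => (f x', g x')) x.
Proof.
  intros Hf Hg.
  apply (continuous_comp_2 f g (fun u v => (u, v))); auto.
  apply continuous_ext with (fun p => p).
  - intros [u v]; reflexivity.
  - apply continuous_id.
Qed.

(* Composing with this retraction onto [a, b] turns continuity relative to the
   interval into continuity on R. *)
Definition clamp (a b x : R) : R := Rmax a (Rmin b x).

Lemma clamp_segment (a b x : R) : a <= b -> segment a b (clamp a b x).
Proof.
  intros H. unfold segment, clamp, Rmax, Rmin.
  repeat destruct Rle_dec; lra.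
Qed.

Lemma clamp_id (a b x : R) : segment a b x -> clamp a b x = x.
Proof.
  intros H. unfold segment, clamp, Rmax, Rmin in *.
  repeat destruct Rle_dec; lra.
Qed.

Lemma clamp_continuous (a b x : R) : continuous (clamp a b) x.
Proof.
  apply (proj2 (filterlim_locally _ _)). intros e. exists e. intros x' Hx'.
  revert Hx'. change (Rabs (x' - x) < e -> Rabs (clamp a b x' - clamp a b x) < e).
  unfold clamp, Rmax, Rmin, Rabs.
  repeat destruct Rle_dec; repeat destruct Rcase_abs; lra.
Qed.

Lemma exp_le_compat (x y : R) : x <= y -> exp x <= exp y.
Proof.
  intros [H | ->]; [apply Rlt_le, exp_increasing, H | apply Rle_refl].
Qed.

(** * Geometric convergence of sequences *)

Lemma is_lim_seq_scal_geom (C k : R) :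
  0 <= k < 1 -> is_lim_seq (fun n => C * k ^ n) 0.
Proof.
  intros Hk. rewrite <- (Rmult_0_r C). apply (is_lim_seq_scal_l _ C 0).
  apply is_lim_seq_geom. rewrite Rabs_pos_eq; lra.
Qed.

(** Applied to the absolute value of a difference, this turns estimates along all iterates into an
    equality, both for the fixed-point equation and for uniqueness. *)
Lemma le_0_of_le_geom (x C k : R) :
  0 <= k < 1 -> (forall n, x <= C * k ^ n) -> x <= 0.
Proof.
  intros Hk Hx.
  pose proof (is_lim_seq_scal_geom C k Hk) as Hg.
  exact (is_lim_seq_le _ _ _ _ Hx (is_lim_seq_const x) Hg).
Qed.

Lemma geom_increments_dist (u : nat -> R) (C k : R) :
  0 <= k < 1 -> (forall n, Rabs (u (S n) - u n) <= C * k ^ n) ->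
  forall n m, Rabs (u (n + m)%nat - u n) <= C / (1 - k) * k ^ n.
Proof.
  intros Hk Hu n m.
  assert (HC : 0 <= C).
  { generalize (Hu 0%nat) (Rabs_pos (u 1%nat - u 0%nat)). simpl. lra. }
  (* The partial geometric sum makes the induction on [m] close: consecutive bounds differ by
     exactly [C * k ^ (n + m)]. The final bound alone would not carry over from [m] to [m + 1]. *)
  apply Rle_trans with (C / (1 - k) * k ^ n * (1 - k ^ m)).
  - induction m as [|m IH].
    + rewrite Nat.add_0_r. unfold Rminus at 1. rewrite Rplus_opp_r, Rabs_R0.
      simpl. lra.
    + rewrite Nat.add_succ_r.
      replace (u (S (n + m)) - u n)
        with ((u (S (n + m)) - u (n + m)%nat) + (u (n + m)%nat - u n)) by ring.
      eapply Rle_trans; [apply Rabs_triang|].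
      eapply Rle_trans; [apply Rplus_le_compat; [apply Hu | apply IH]|].
      rewrite pow_add. apply Req_le. simpl. field. lra.
  - rewrite <- (Rmult_1_r (C / (1 - k) * k ^ n)) at 2.
    apply Rmult_le_compat_l.
    + apply Rmult_le_pos; [apply Rdiv_le_0_compat; lra | apply pow_le; lra].
    + generalize (pow_le k m). lra.
Qed.

(** The bound of [geom_increments_dist] is uniform in its second index. It makes the sequence
    Cauchy, so that the total function [Lim_seq] returns a genuine finite limit, and it then
    survives letting that index tend to infinity. *)
Lemma geom_increments_Lim_seq (u : nat -> R) (C k : R) :
  0 <= k < 1 -> (forall n, Rabs (u (S n) - u n) <= C * k ^ n) ->
  forall n, Rabs (u n - real (Lim_seq u)) <= C / (1 - k) * k ^ n.
Proof.
  intros Hk Hu n.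
  set (D := C / (1 - k)).
  pose proof (geom_increments_dist u C k Hk Hu) as Hd. fold D in Hd.
  assert (Hl : is_lim_seq u (real (Lim_seq u))).
  { apply Lim_seq_correct', ex_lim_seq_cauchy_corr. intros e.
    (* Both [u p] and [u q] are compared with [u N], hence the factor 2. *)
    pose proof (is_lim_seq_scal_geom (2 * D) k Hk) as Hg.
    apply is_lim_seq_spec in Hg.
    destruct (Hg e) as [N HN]. exists N. intros p q Hp Hq.
    specialize (HN N (Nat.le_refl N)).
    apply Rle_lt_trans with (2 * D * k ^ N).
    - replace p with (N + (p - N))%nat by lia.
      replace q with (N + (q - N))%nat by lia.
      set (p' := (p - N)%nat). set (q' := (q - N)%nat).
      replace (u (N + p')%nat - u (N + q')%nat)
        with ((u (N + p')%nat - u N) - (u (N + q')%nat - u N)) by ring.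
      eapply Rle_trans; [apply Rabs_triang|]. rewrite Rabs_Ropp.
      generalize (Hd N p') (Hd N q'). lra.
    - rewrite Rminus_0_r in HN. eapply Rle_lt_trans; [apply Rle_abs | exact HN]. }
  assert (Hl' : is_lim_seq (fun m => Rabs (u (m + n)%nat - u n))
                  (Rabs (real (Lim_seq u) - u n))).
  { apply (is_lim_seq_abs _ (real (Lim_seq u) - u n)).
    apply is_lim_seq_minus'; [| apply is_lim_seq_const].
    apply -> (is_lim_seq_incr_n u n). exact Hl. }
  rewrite Rabs_minus_sym.
  refine (is_lim_seq_le _ _ _ _ _ Hl' (is_lim_seq_const (D * k ^ n))).
  intros m. rewrite Nat.add_comm. apply Hd.
Qed.

(** The geometric rate is uniform in [x'], so the usual e/3 argument applies. The bound is asked on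
    all of R, which is why [fixed_point_near] evaluates its iterates at clamped points. *)
Lemma continuous_of_geom_limit (u : nat -> R -> R) (l : R -> R) (C k x : R) :
  0 <= k < 1 -> (forall n x', Rabs (u n x' - l x') <= C * k ^ n) ->
  (forall n, continuous (u n) x) -> continuous l x.
Proof.
  intros Hk Hu Hc. apply (proj2 (filterlim_locally _ _)). intros e.
  pose proof (is_lim_seq_scal_geom C k Hk) as Hg.
  apply is_lim_seq_spec in Hg.
  assert (He : 0 < e / 3) by (generalize (cond_pos e); lra).
  destruct (Hg (mkposreal _ He)) as [N HN].
  specialize (HN N (Nat.le_refl N)). simpl in HN. rewrite Rminus_0_r in HN.
  generalize (proj1 (filterlim_locally _ _) (Hc N) (mkposreal _ He)).
  apply filter_imp. intros x' Hx'.
  change (Rabs (u N x' - u N x) < e / 3) in Hx'.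
  change (Rabs (l x' - l x) < e).
  replace (l x' - l x)
    with ((u N x' - u N x) + ((u N x - l x) + - (u N x' - l x'))) by ring.
  eapply Rle_lt_trans; [apply Rabs_triang|].
  assert (H := Rabs_triang (u N x - l x) (- (u N x' - l x'))).
  rewrite Rabs_Ropp in H.
  generalize (Hu N x) (Hu N x') (Rle_abs (C * k ^ N)). lra.
Qed.

(** * Integrals depending on a parameter, and the Volterra operator *)

Lemma continuous_RInt_param (h : R -> R -> R) (a t : R) :
  (forall t' s, continuous (fun p : R * R => h (fst p) (snd p)) (t', s)) ->
  continuous (fun t' => RInt (h t') a t') t.
Proof.
  intros Hh.
  assert (Hc : forall t' s, continuous (h t') s).
  { intros t' s. apply (continuous_comp_2 (fun _ => t') (fun s => s) h).
    - apply continuous_const.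
    - apply continuous_id.
    - apply Hh. }
  assert (Hex : forall t' c d, ex_RInt (h t') c d).
  { intros t' c d. apply (ex_RInt_continuous (h t')). intros; apply Hc. }
  (* The increment splits in two, each part getting e/2: replacing the integrand [h t'] by [h t] up
     to [t'], and moving the endpoint for the fixed integrand [h t]. The first uses uniform
     continuity in [s] over a compact interval containing every range from [a] to [t'] with [t']
     within 1 of [t]; [M] bounds the length of such ranges. *)
  apply (proj2 (filterlim_locally _ _)). intros e.
  set (M := Rabs (t - a) + 1).
  assert (HM : 0 < M) by (unfold M; generalize (Rabs_pos (t - a)); lra).
  assert (He : 0 < e / 2) by (generalize (cond_pos e); lra).
  assert (He' : 0 < e / 2 / M) by (apply Rdiv_lt_0_compat; lra).
  destruct (uniform_continuity_2d_1d' h (Rmin a (t - 1)) (Rmax a (t + 1)) t)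
    with (eps := mkposreal _ He') as [d Hd].
  { intros s _. apply continuity_2d_pt_filterlim, Hh. }
  simpl in Hd.
  assert (H1 : locally t (fun t' => Rabs (t' - t) < Rmin d 1)).
  { assert (Hm : 0 < Rmin d 1) by (apply Rmin_pos; [apply cond_pos | lra]).
    exists (mkposreal _ Hm). intros t' Ht'. exact Ht'. }
  assert (H2 : continuous (fun t' => RInt (h t) a t') t).
  { apply (continuous_RInt_1 (h t) a t).
    apply filter_forall. intros z. apply (RInt_correct (h t)), Hex. }
  generalize (filter_and _ _ H1
    (proj1 (filterlim_locally _ _) H2 (mkposreal _ He))).
  apply filter_imp. intros t' [Ht' HI].
  change (Rabs (RInt (h t) a t' - RInt (h t) a t) < e / 2) in HI.
  change (Rabs (RInt (h t') a t' - RInt (h t) a t) < e).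
  assert (Hd1 : Rabs (t' - t) <= d).
  { apply Rlt_le, Rlt_le_trans with (1 := Ht'), Rmin_l. }
  assert (Ht1 : Rabs (t' - t) < 1).
  { apply Rlt_le_trans with (1 := Ht'), Rmin_r. }
  assert (HJ : Rabs (RInt (h t') a t' - RInt (h t) a t')
               <= Rabs (t' - a) * (e / 2 / M)).
  { apply (norm_RInt_le_const_abs (fun s => h t' s - h t s) a t').
    - intros s Hs. apply Rlt_le.
      apply Rabs_def2 in Ht1. apply Rabs_le_between in Hd1.
      assert (Hs' : Rmin a (t - 1) <= s <= Rmax a (t + 1)).
      { revert Hs. unfold Rmin, Rmax. repeat destruct Rle_dec; lra. }
      apply Hd; try exact Hs'.
      + generalize (cond_pos d); lra.
      + lra.
      + rewrite Rminus_diag, Rabs_R0. apply cond_pos.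
    - apply (is_RInt_minus (h t') (h t));
        apply (RInt_correct (V := R_CompleteNormedModule)), Hex. }
  assert (HJ' : Rabs (t' - a) * (e / 2 / M) <= e / 2).
  { apply Rle_trans with (M * (e / 2 / M)).
    - apply Rmult_le_compat_r; [lra|]. unfold M.
      replace (t' - a) with ((t - a) + (t' - t)) by ring.
      eapply Rle_trans; [apply Rabs_triang|]. lra.
    - apply Req_le. field. lra. }
  replace (RInt (h t') a t' - RInt (h t) a t)
    with ((RInt (h t') a t' - RInt (h t) a t') + (RInt (h t) a t' - RInt (h t) a t))
    by ring.
  eapply Rle_lt_trans; [apply Rabs_triang|]. lra.
Qed.

(** The analysis is carried out for kernels continuous on the whole space; [clamped_kernel] later
    reduces the given kernel to this case. *)
Definition jointly_continuous (g : R -> R -> R -> R) : Prop :=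
  forall p, continuous (fun p : R * R * R => g (fst (fst p)) (snd (fst p)) (snd p)) p.

Definition volterra (g : R -> R -> R -> R) (a : R) (u : R -> R) (t : R) : R :=
  RInt (fun s => g t s (u s)) a t.

Lemma continuous_integrand (g : R -> R -> R -> R) (u : R -> R) :
  jointly_continuous g -> (forall s, continuous u s) ->
  forall p, continuous (fun p : R * R => g (fst p) (snd p) (u (snd p))) p.
Proof.
  intros Hg Hu p.
  apply (continuous_comp (fun p : R * R => (p, u (snd p)))
    (fun p : R * R * R => g (fst (fst p)) (snd (fst p)) (snd p))).
  - apply continuous_pair; [apply continuous_id|].
    apply (continuous_comp snd u); [|apply Hu].
    destruct p. apply continuous_snd.
  - apply Hg.
Qed.

Lemma volterra_continuous (g : R -> R -> R -> R) (a : R) (u : R -> R) (t : R) :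
  jointly_continuous g -> (forall s, continuous u s) ->
  continuous (volterra g a u) t.
Proof.
  intros Hg Hu. apply (continuous_RInt_param (fun t s => g t s (u s))).
  intros. apply (continuous_integrand g u Hg Hu).
Qed.

Lemma ex_RInt_volterra (g : R -> R -> R -> R) (u : R -> R) (t c d : R) :
  jointly_continuous g -> (forall s, continuous u s) ->
  ex_RInt (fun s => g t s (u s)) c d.
Proof.
  intros Hg Hu. apply (ex_RInt_continuous (fun s => g t s (u s))). intros s _.
  apply (continuous_comp_2 (fun _ => t) (fun s => s) (fun t s => g t s (u s))).
  - apply continuous_const.
  - apply continuous_id.
  - apply (continuous_integrand g u Hg Hu).
Qed.

(* The weight [exp (eta * (t - a))] is Bielecki's: integrating it gains the
   factor [/ eta], so the operator contracts by [L / eta < 1] on an interval of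
   any length. *)
Lemma volterra_contraction (g : R -> R -> R -> R) (a b L eta : R)
    (u v : R -> R) (M : R) :
  jointly_continuous g ->
  (forall t s z1 z2, Rabs (g t s z1 - g t s z2) <= L * Rabs (z1 - z2)) ->
  0 < L -> 0 < eta ->
  (forall s, continuous u s) -> (forall s, continuous v s) ->
  (forall s, segment a b s -> Rabs (u s - v s) <= M * exp (eta * (s - a))) ->
  forall t, segment a b t ->
  Rabs (volterra g a u t - volterra g a v t) <= M * (L / eta) * exp (eta * (t - a)).
Proof.
  intros Hg HL HL0 Heta Hu Hv Huv t Ht.
  (* At [s = a] the weight is 1, so [M] dominates an absolute value. *)
  assert (HM : 0 <= M).
  { assert (Ha : segment a b a) by (unfold segment in *; lra).
    specialize (Huv a Ha). rewrite Rminus_diag, Rmult_0_r, exp_0 in Huv.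
    generalize (Rabs_pos (u a - v a)). lra. }
  (* A primitive of the Lipschitz bound on the integrand. Its value at [a] is nonnegative and is
     dropped at the end. *)
  set (G := fun s => M * (L / eta) * exp (eta * (s - a))).
  assert (HI : is_RInt (fun s => L * (M * exp (eta * (s - a)))) a t (G t - G a)).
  { apply (is_RInt_derive G).
    - intros s _. unfold G. auto_derive; [exact I|]. unfold Rminus. field. lra.
    - intros s _. apply (ex_derive_continuous (V := R_NormedModule)).
      auto_derive. exact I. }
  apply Rle_trans with (G t - G a).
  - apply (norm_RInt_le (fun s => g t s (u s) - g t s (v s))
             (fun s => L * (M * exp (eta * (s - a)))) a t _ _); try exact HI.
    + apply Ht.
    + intros s Hs. eapply Rle_trans; [apply HL|].
      apply Rmult_le_compat_l; [lra|]. apply Huv. unfold segment in *; lra.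
    + apply (is_RInt_minus (fun s => g t s (u s)) (fun s => g t s (v s)));
        apply (RInt_correct (V := R_CompleteNormedModule)), ex_RInt_volterra; assumption.
  - assert (0 <= G a); [|fold (G t); lra].
    unfold G. apply Rmult_le_pos; [|apply Rlt_le, exp_pos].
    apply Rmult_le_pos; [exact HM|]. apply Rdiv_le_0_compat; lra.
Qed.

(** * Picard iterates and fixed points *)

Fixpoint picard (g : R -> R -> R -> R) (a : R) (y : R -> R) (n : nat) : R -> R :=
  match n with
  | O => y
  | S n => volterra g a (picard g a y n)
  end.

Lemma picard_continuous (g : R -> R -> R -> R) (a : R) (y : R -> R) (n : nat) (t : R) :
  jointly_continuous g -> (forall s, continuous y s) ->
  continuous (picard g a y n) t.
Proof.
  intros Hg Hy. revert t. induction n as [|n IH]; intros t; [apply Hy|].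
  apply (volterra_continuous g a _ t Hg IH).
Qed.

(** Each application of the operator leaves two fixed points unchanged but shrinks the bound on
    their weighted distance by [L / eta]. The a priori bound [M] starts the induction; the weight is
    at least 1, so [M] also bounds the weighted distance. *)
Lemma fixed_point_unique (g : R -> R -> R -> R) (a b L eta M : R) (u v : R -> R) :
  jointly_continuous g ->
  (forall t s z1 z2, Rabs (g t s z1 - g t s z2) <= L * Rabs (z1 - z2)) ->
  0 < L < eta ->
  (forall s, continuous u s) -> (forall s, continuous v s) ->
  (forall t, segment a b t -> u t = volterra g a u t) ->
  (forall t, segment a b t -> v t = volterra g a v t) ->
  (forall t, segment a b t -> Rabs (u t - v t) <= M) ->
  forall t, segment a b t -> u t = v t.
Proof.
  intros Hg HL Heta Hu Hv Eu Ev HM t Ht.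
  assert (Hk : 0 <= L / eta < 1).
  { split; [apply Rdiv_le_0_compat; lra|]. apply Rlt_div_l; lra. }
  assert (Hn : forall n s, segment a b s ->
            Rabs (u s - v s) <= M * (L / eta) ^ n * exp (eta * (s - a))).
  { induction n as [|n IH]; intros s Hs.
    - simpl. rewrite Rmult_1_r.
      assert (1 <= exp (eta * (s - a))).
      { rewrite <- exp_0. apply exp_le_compat. apply Rmult_le_pos; unfold segment in Hs; lra. }
      generalize (HM s Hs) (Rabs_pos (u s - v s)). nra.
    - rewrite (Eu s Hs), (Ev s Hs).
      replace (M * (L / eta) ^ S n) with (M * (L / eta) ^ n * (L / eta)) by (simpl; ring).
      apply (volterra_contraction g a b L eta); auto; lra. }
  apply Rminus_diag_uniq.
  assert (H0 : Rabs (u t - v t) <= 0).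
  { apply (le_0_of_le_geom _ (M * exp (eta * (t - a))) (L / eta) Hk). intros n.
    generalize (Hn n t Ht). lra. }
  generalize (Rle_abs (u t - v t)) (Rle_abs (- (u t - v t))).
  rewrite Rabs_Ropp. lra.
Qed.

Lemma fixed_point_near (g : R -> R -> R -> R) (a b L eta eps : R) (y : R -> R) :
  a <= b ->
  jointly_continuous g ->
  (forall t s z1 z2, Rabs (g t s z1 - g t s z2) <= L * Rabs (z1 - z2)) ->
  0 < L < eta -> 0 <= eps ->
  (forall s, continuous y s) ->
  (forall t, segment a b t -> Rabs (y t - volterra g a y t) <= eps) ->
  exists u : R -> R,
    (forall s, continuous u s) /\
    forall t, segment a b t ->
      u t = volterra g a u t /\
      Rabs (y t - u t) <= eps * exp (eta * (b - a)) / (1 - L / eta).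
Proof.
  intros Hab Hg HL Heta Heps Hy Hyeps.
  set (k := L / eta).
  assert (Hk : 0 <= k < 1).
  { unfold k. split; [apply Rdiv_le_0_compat; lra|]. apply Rlt_div_l; lra. }
  assert (Hw : forall s, segment a b s -> 1 <= exp (eta * (s - a)) <= exp (eta * (b - a))).
  { intros s Hs. rewrite <- exp_0 at 1. unfold segment in Hs.
    split; apply exp_le_compat; [apply Rmult_le_pos|apply Rmult_le_compat_l]; lra. }
  pose proof (fun n t => picard_continuous g a y n t Hg Hy) as Hpc.
  assert (Hp : forall n t, segment a b t ->
     Rabs (picard g a y (S n) t - picard g a y n t) <= eps * k ^ n * exp (eta * (t - a))).
  { induction n as [|n IH]; intros t Ht.
    - simpl. rewrite Rmult_1_r, Rabs_minus_sym.
      generalize (Hyeps t Ht) (Hw t Ht). nra.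
    - replace (eps * k ^ S n) with (eps * k ^ n * k) by (simpl; ring).
      apply (volterra_contraction g a b L eta (picard g a y (S n)) (picard g a y n)); auto; lra. }
  set (E := exp (eta * (b - a))).
  (* [E] is the largest weight on the interval, so the increments of the iterates are at most
     [eps * E * k ^ n]; dividing by [1 - k] sums the series. *)
  set (C := eps * E / (1 - k)).
  (* Clamping the argument extends the limit by constants outside the interval, so convergence is
     uniform on R and [u] is continuous everywhere. *)
  set (u := fun t => real (Lim_seq (fun n => picard g a y n (clamp a b t)))).
  assert (Hlim : forall n t, Rabs (picard g a y n (clamp a b t) - u t) <= C * k ^ n).
  { intros n t. apply (geom_increments_Lim_seq (fun n => picard g a y n (clamp a b t))); [exact Hk|].
    clear n; intros n. pose proof (clamp_segment a b t Hab) as Ht.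
    eapply Rle_trans; [apply (Hp n _ Ht)|].
    replace (eps * E * k ^ n) with (eps * k ^ n * E) by ring.
    apply Rmult_le_compat_l; [|apply (Hw _ Ht)].
    apply Rmult_le_pos; [exact Heps|]. apply pow_le; lra. }
  assert (Hu : forall s, continuous u s).
  { intros s. apply (continuous_of_geom_limit (fun n t => picard g a y n (clamp a b t)) u C k); auto.
    intros n. apply (continuous_comp (clamp a b)); [apply clamp_continuous|apply Hpc]. }
  assert (Hseg : forall n t, segment a b t -> Rabs (picard g a y n t - u t) <= C * k ^ n).
  { intros n t Ht. rewrite <- (clamp_id a b t Ht) at 1. apply Hlim. }
  assert (HC : 0 <= C).
  { unfold C. apply Rdiv_le_0_compat; [|lra]. apply Rmult_le_pos; [lra|].
    apply Rlt_le, exp_pos. }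
  exists u. split; [exact Hu|]. intros t Ht. split.
  - apply Rminus_diag_uniq.
    assert (H0 : Rabs (u t - volterra g a u t) <= 0).
    (* Compare through iterate [n + 1]: the first term bounds its distance to [u], the second comes
       from contracting the distance between iterate [n] and [u]. *)
    { apply (le_0_of_le_geom _ (C * k + C * k * exp (eta * (t - a))) k Hk). intros n.
      assert (H1 := Hseg (S n) t Ht).
      assert (H2 : Rabs (volterra g a (picard g a y n) t - volterra g a u t)
                   <= C * k ^ n * k * exp (eta * (t - a))).
      { apply (volterra_contraction g a b L eta); auto; try lra.
        intros s Hs. apply Rle_trans with (1 := Hseg n s Hs).
        rewrite <- Rmult_1_r at 1. apply Rmult_le_compat_l; [|apply (Hw s Hs)].
        apply Rmult_le_pos; [exact HC|]. apply pow_le; lra. }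
      replace (u t - volterra g a u t)
        with ((volterra g a (picard g a y n) t - volterra g a u t)
              + - (picard g a y (S n) t - u t)) by (simpl; ring).
      eapply Rle_trans; [apply Rabs_triang|]. rewrite Rabs_Ropp.
      simpl pow in H1. lra. }
    generalize (Rle_abs (u t - volterra g a u t)) (Rle_abs (- (u t - volterra g a u t))).
    rewrite Rabs_Ropp. lra.
  (* Iterate 0 is [y] itself, so the rate at index 0 is the required estimate. *)
  - generalize (Hseg 0%nat t Ht). simpl. rewrite Rmult_1_r. trivial.
Qed.

(** * Transfer between the interval and the whole line *)

Lemma continuous_clamp_comp (a b : R) (u : R -> R) (s : R) :
  a <= b -> continuous_on (segment a b) u -> continuous (fun s => u (clamp a b s)) s.
Proof.
  intros Hab Hu. apply (continuous_on_comp (segment a b) (clamp a b) u s); auto.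
  - intros; apply clamp_segment, Hab.
  - apply clamp_continuous.
Qed.

(** Only the time variables are restricted in the hypotheses on [f], so clamping them makes
    continuity and the Lipschitz bound global. *)
Definition clamped_kernel (a b : R) (f : R -> R -> R -> R) (t s z : R) : R :=
  f (clamp a b t) (clamp a b s) z.

Lemma clamped_kernel_continuous (a b : R) (f : R -> R -> R -> R) :
  a <= b -> continuous_kernel a b f -> jointly_continuous (clamped_kernel a b f).
Proof.
  intros Hab Hf p.
  apply (continuous_on_comp
    (fun p : R * R * R => segment a b (fst (fst p)) /\ segment a b (snd (fst p)))
    (fun p : R * R * R => (clamp a b (fst (fst p)), clamp a b (snd (fst p)), snd p))
    (fun p : R * R * R => f (fst (fst p)) (snd (fst p)) (snd p))).
  1: { intros q; split; apply clamp_segment, Hab. }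
  2: exact Hf.
  destruct p as [[t s] z].
  repeat apply continuous_pair.
  - apply (continuous_comp (fun p : R * R * R => fst (fst p)) (clamp a b)); [|apply clamp_continuous].
    apply (continuous_comp fst fst); apply continuous_fst.
  - apply (continuous_comp (fun p : R * R * R => snd (fst p)) (clamp a b)); [|apply clamp_continuous].
    apply (continuous_comp fst snd); [apply continuous_fst|apply continuous_snd].
  - apply continuous_snd.
Qed.

(** For [t] in the interval the integration range stays inside it, where clamping is the
    identity. *)
Lemma volterra_clamped (a b : R) (f : R -> R -> R -> R) (u v : R -> R) (t : R) :
  (forall s, segment a b s -> u s = v s) -> segment a b t ->
  volterra (clamped_kernel a b f) a u t = RInt (fun s => f t s (v s)) a t.
Proof.
  intros Huv Ht. apply (RInt_ext (V := R_CompleteNormedModule)).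
  rewrite Rmin_left, Rmax_right by apply Ht. intros s Hs.
  assert (Hs' : segment a b s) by (unfold segment in *; lra).
  unfold clamped_kernel. rewrite !clamp_id, Huv; auto.
Qed.

Theorem corollary2p8 (t0 r : R) (hr : 0 < r)
    (f : R -> R -> R -> R)
    (hf : continuous_kernel t0 (t0 + r) f)
    (L : R) (hL : 0 < L)
    (hLip : forall t s z1 z2 : R,
        segment t0 (t0 + r) t -> segment t0 (t0 + r) s ->
        Rabs (f t s z1 - f t s z2) <= L * Rabs (z1 - z2))
    (eps : R) (heps : 0 <= eps)
    (eta : R) (heta : L < eta)
    (y : R -> R)
    (hy : continuous_on (segment t0 (t0 + r)) y)
    (hyeps : forall t : R, segment t0 (t0 + r) t ->
        Rabs (y t - RInt (fun s => f t s (y s)) t0 t) <= eps) :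
  exists y0 : R -> R,
    (volterra_solution t0 (t0 + r) f y0 /\
     forall t : R, segment t0 (t0 + r) t ->
       Rabs (y t - y0 t) <= eps * exp (eta * r) / (1 - L / eta)) /\
    forall z : R -> R,
      (volterra_solution t0 (t0 + r) f z /\
       forall t : R, segment t0 (t0 + r) t ->
         Rabs (y t - z t) <= eps * exp (eta * r) / (1 - L / eta)) ->
      forall t : R, segment t0 (t0 + r) t -> z t = y0 t.
Proof.
  set (b := t0 + r) in *.
  assert (Hab : t0 <= b) by (unfold b; lra).
  set (g := clamped_kernel t0 b f).
  pose proof (clamped_kernel_continuous t0 b f Hab hf) as Hg. fold g in Hg.
  assert (HgL : forall t s z1 z2, Rabs (g t s z1 - g t s z2) <= L * Rabs (z1 - z2)).
  { intros. apply hLip; apply clamp_segment, Hab. }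
  assert (Hcl : forall (u : R -> R) s, segment t0 b s -> u (clamp t0 b s) = u s).
  { intros u s Hs. rewrite clamp_id; auto. }
  (* [y] is continuous only relative to the interval, so its clamped extension is used; [Hcl]
     removes the clamp on the interval. *)
  destruct (fixed_point_near g t0 b L eta eps (fun s => y (clamp t0 b s)))
    as [y0 [Hc0 H0]]; auto.
  - intros s. apply continuous_clamp_comp; auto.
  - intros t Ht. rewrite (Hcl y t Ht). unfold g.
    rewrite (volterra_clamped t0 b f _ y t (Hcl y) Ht). auto.
  - replace (b - t0) with r in H0 by (unfold b; ring).
    assert (Hy0 : forall t, segment t0 b t ->
      Rabs (y t - y0 t) <= eps * exp (eta * r) / (1 - L / eta)).
    { intros t Ht. rewrite <- (Hcl y t Ht). apply (H0 t Ht). }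
    exists y0. split; [split; [split|]|]; auto.
    + apply continuous_on_forall. auto.
    + intros t Ht. rewrite <- (volterra_clamped t0 b f y0 y0 t); auto. apply (H0 t Ht).
    + intros z [[Hzc Hz] Hzy] t Ht. rewrite <- (Hcl z t Ht).
      (* Both solutions lie within the stated distance of [y], so twice that distance bounds their
         difference. *)
      apply (fixed_point_unique g t0 b L eta
               (2 * (eps * exp (eta * r) / (1 - L / eta))) (fun s => z (clamp t0 b s)) y0); auto.
      * intros s. apply continuous_clamp_comp; auto.
      * intros s Hs. unfold g. rewrite (Hcl z s Hs), (volterra_clamped t0 b f _ z s (Hcl z) Hs). auto.
      * intros s Hs. apply (H0 s Hs).
      * intros s Hs. rewrite (Hcl z s Hs).
        replace (z s - y0 s) with ((y s - y0 s) + - (y s - z s)) by ring.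
        eapply Rle_trans; [apply Rabs_triang|]. rewrite Rabs_Ropp.
        generalize (Hy0 s Hs) (Hzy s Hs). lra.
Qed.
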